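(* For each $n\geq 1$, let $d_n$ denote the smallest nonnegative integer such that whenever $X$ and $Y$ are $n$-vertex graphs with $\delta(X)\geq d_n$ and $\delta(Y)\geq d_n$, the friends-and-strangers graph $\mathsf{FS}(X,Y)$ is connected. Then for every $n\ge 1$, $$d_n\geq \frac{3}{5}n-2,$$ and if $n\geq 16$, then $$d_n\leq\frac{9}{14}n+2.$$
   Context: All graphs are simple; $\delta(G)$ denotes the minimum degree of $G$. For graphs $X$ and $Y$ with $|V(X)|=|V(Y)|$, the friends-and-strangers graph $\mathsf{FS}(X,Y)$ is the graph whose vertices are all bijections $\sigma:V(X)\to V(Y)$, where two bijections $\sigma,\sigma'$ are adjacent if and only if there is an edge $\{a,b\}\in E(X)$ such that $\{\sigma(a),\sigma(b)\}\in E(Y)$, $\sigma(a)=\sigma'(b)$, $\sigma(b)=\sigma'(a)$, and $\sigma(c)=\sigma'(c)$ for all $c\in V(X)\setminus\{a,b\}$. *)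

(* Defs.v *)
From mathcomp Require Import all_boot.
From mathcomp Require Import boolp.

Set Implicit Arguments.
Unset Strict Implicit.
Unset Printing Implicit Defensive.

Record sgraph := SGraph {
  vertex :> finType;
  adj : rel vertex;
  adj_sym : symmetric adj;
  adj_irrefl : irreflexive adj
}.

Definition degree (G : sgraph) (x : G) : nat := #|[set y | adj x y]|.

(* Every degree is smaller than #|G|, so the default value of the minimum is
   only reached when G has no vertex. *)
Definition min_degree (G : sgraph) : nat :=
  \big[minn/#|G|]_(x : G) degree x.

Definition connected (G : sgraph) : Prop :=
  forall x y : G, connect (@adj G) x y.

Definition bijectiveb (aT rT : finType) (f : {ffun aT -> rT}) : bool :=
  injectiveb f && [forall y, y \in codom f].

Definition bijection (aT rT : finType) : finType :=
  {f : {ffun aT -> rT} | bijectiveb f}.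

Definition fs_adj (X Y : sgraph) : rel (bijection X Y) := fun s t =>
  [exists a : X, [exists b : X,
    [&& adj a b, adj (val s a) (val s b),
        val s a == val t b, val s b == val t a &
        [forall c : X, (c != a) && (c != b) ==> (val s c == val t c)]]]].

Lemma fs_adj_sym (X Y : sgraph) : symmetric (@fs_adj X Y).
Proof.
suff imp (s t : bijection X Y) : fs_adj s t -> fs_adj t s.
  by move=> s t; apply/idP/idP; apply: imp.
case/existsP=> a /existsP[b /and5P[ab sab /eqP e1 /eqP e2 /forallP h]].
apply/existsP; exists a; apply/existsP; exists b.
rewrite ab -e1 -e2 adj_sym sab !eqxx /=.
by apply/forallP=> c; rewrite [val t c == _]eq_sym; exact: h.
Qed.

Lemma fs_adj_irrefl (X Y : sgraph) : irreflexive (@fs_adj X Y).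
Proof.
move=> s; apply/negbTE/negP; rewrite /fs_adj.
case/existsP=> a /existsP[b /and5P[_ sab /eqP e _ _]].
by rewrite e adj_irrefl in sab.
Qed.

Definition FS (X Y : sgraph) : sgraph :=
  SGraph (@fs_adj_sym X Y) (@fs_adj_irrefl X Y).

Definition forces_connected (n d : nat) : Prop :=
  forall X Y : sgraph, #|X| = n -> #|Y| = n ->
    d <= min_degree X -> d <= min_degree Y -> connected (FS X Y).

Lemma min_degree_le (G : sgraph) : min_degree G <= #|G|.
Proof.
apply: (big_ind (fun m => m <= #|G|)) => // [m p hm _|x _].
  by rewrite geq_min hm.
exact: max_card.
Qed.

(* No graph on n vertices has minimum degree n.+1, so n.+1 works vacuously. *)
Lemma ex_forces_connected (n : nat) :
  exists d, `[< forces_connected n d >].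
Proof.
exists n.+1; apply/asboolP=> X Y cX _ hX _.
by have := leq_trans hX (min_degree_le X); rewrite cX ltnn.
Qed.

Definition d_ (n : nat) : nat := ex_minn (ex_forces_connected n).

(* Main.v *)
Require Import Defs.
From mathcomp Require Import all_boot all_order all_algebra.
From mathcomp Require Import fingroup perm zify lra boolp.
Import Order.TTheory GRing.Theory Num.Theory.

(** Lower bound.  Cut the n vertices into five blocks according to their
    residue modulo 5.  In X join blocks at cyclic distance 0 or 1, in Y those
    at distance 0 or 2.  A swap needs adjacency in both graphs, so it happens
    inside one block, and no bijection reached from the identity moves a
    vertex out of its block ([not_forces_connected]).  Every closed
    neighbourhood consists of three blocks, about 3n/5 vertices.

    Upper bound.  Fix one bijection; every other one becomes a permutation of
    the vertices of X, a placement of persons on positions, and a swap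
    multiplies it on the left by a transposition.  As X is well connected, all
    placements are reachable once the persons on any X-adjacent positions a, b
    can be exchanged with everybody else left in place.  If they are not
    Y-adjacent, it suffices that a common Y-neighbour of the two persons
    stands on a common X-neighbour of a and b: then three swaps do it
    ([reach_exchange]).  Let P be the set of these positions and Q the set of
    these persons.  It remains to bring a person of Q to a position of P by
    moves avoiding a and b; undoing these moves afterwards leaves just the
    exchange.

    This is [meets_of_mindeg], on the graphs without a and b.  Its heart is
    [meets_adj]: it can be done if some q in Q is Y-adjacent to the person on
    some p in P.  Let A be the closed Y-neighbourhood of q, and let q walk
    through positions occupied by A, along X-edges; it can swap with everybody
    it meets.  If the component K of q in X[A] does not contain p, there is no
    X-edge between K and L = A - K, both have size about 2/7 n at least, so
    each vertex of A already spends most of its non-adjacencies on A and is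
    X-adjacent to almost everything outside A.  By averaging, some position mu
    outside A is X-adjacent to almost all of A, and the person there is
    Y-adjacent to some k0 in A among these.  Swapping mu and k0 puts a
    Y-neighbour of q on mu, a bridge from K to L over which q walks to p.

    Exchanging the roles of X and Y inverts the permutations, which settles
    the case of an X-edge between P and the positions of Q.  If there is no
    edge of either kind, a vertex r adjacent to some p in P in both graphs and
    to some q in Q in Y exists by counting, and swapping p and r leads back to
    [meets_adj]. *)

Set Implicit Arguments.
Unset Strict Implicit.
Unset Printing Implicit Defensive.

(** * Paths and counting in neighbourhoods *)

Lemma connect_homo (T U : finType) (e : rel T) (e' : rel U) (f : T -> U) x y :
    (forall x y, e x y -> e' (f x) (f y)) ->
  connect e x y -> connect e' (f x) (f y).
Proof.
move=> h /connectP[p + ->]; elim: p x => //= z p IH x /andP[xz zp].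
exact: connect_trans (connect1 (h _ _ xz)) (IH _ zp).
Qed.

Lemma pick_mem3 (T : finType) (S A B C : {set T}) :
    #|S :\: A| + #|S :\: B| + #|S :\: C| < #|S| ->
  exists x, [/\ x \in S, x \in A, x \in B & x \in C].
Proof.
move=> h; case: (set_0Vmem (S :&: A :&: B :&: C)) => [e0 | [x]]; last first.
  by rewrite !inE => /andP[/andP[/andP[]]]; exists x.
suff sub : S \subset (S :\: A) :|: (S :\: B) :|: (S :\: C).
  have := subset_leq_card sub.
  have := cardsUI (S :\: A :|: S :\: B) (S :\: C).
  have := cardsUI (S :\: A) (S :\: B); lia.
apply/subsetP=> x xS; have /setP/(_ x) := e0; rewrite !inE xS /=.
by case: (x \in A); case: (x \in B); case: (x \in C).
Qed.

Section Neighbourhoods.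
Variable V : finType.
Implicit Types X Y : rel V.

Definition nbhd X x : {set V} := [set y | X x y].
Definition cnbhd X x : {set V} := x |: nbhd X x.

Record mindeg_graph X d : Prop := MindegGraph {
  mg_sym : symmetric X;
  mg_irr : irreflexive X;
  mg_deg : forall x, d <= #|nbhd X x|
}.

Lemma cnbhd_card X d x : mindeg_graph X d -> d < #|cnbhd X x|.
Proof. by case=> _ irr deg; rewrite cardsU1 inE irr add1n ltnS. Qed.

(** The three sets counted are pairwise disjoint: non-neighbours of x in L leave
    little room for non-neighbours elsewhere. *)
Lemma card_miss_le X d x (S L : {set V}) :
    mindeg_graph X d -> [disjoint L & S] -> [disjoint L & nbhd X x] ->
  #|S :\: nbhd X x| + #|L| + d <= #|V|.
Proof.
move=> gX dLS dLN; have := mg_deg gX x.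
have := cardsUI (S :\: nbhd X x) L.
have := cardsUI (S :\: nbhd X x :|: L) (nbhd X x).
have := subset_leq_card (subsetT (S :\: nbhd X x :|: L :|: nbhd X x)).
rewrite cardsT.
have -> : (S :\: nbhd X x) :&: L = set0.
  by apply/eqP; rewrite setI_eq0 disjoint_sym (disjointWr (subsetDl _ _)).
have -> : (S :\: nbhd X x :|: L) :&: nbhd X x = set0.
  rewrite setIUl; move: dLN; rewrite -setI_eq0 => /eqP->.
  by rewrite setU0 setIDAC setDE -setIA setICr setI0.
rewrite cards0; lia.
Qed.

(** Double counting of the X-nonadjacent pairs between A and B. *)
Lemma sum_missC X (A B : {set V}) : symmetric X ->
  \sum_(b in B) #|A :\: nbhd X b| = \sum_(a in A) #|B :\: nbhd X a|.
Proof.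
move=> sX.
have E (C : {set V}) x : #|C :\: nbhd X x| = \sum_(c in C) ~~ X x c.
  rewrite -sum1_card big_mkcond [RHS]big_mkcond /=; apply: eq_bigr => c _.
  by rewrite !inE andbC; case: (c \in C); case: (X x c).
rewrite (eq_bigr _ (fun b _ => E A b)) exchange_big /=.
by apply: eq_bigr => a _; rewrite E; apply: eq_bigr => b _; rewrite sX.
Qed.

Lemma card_nbhdI X d a b : mindeg_graph X d ->
  2 * d <= #|nbhd X a :&: nbhd X b| + #|V|.
Proof.
case=> _ _ dX; have := cardsUI (nbhd X a) (nbhd X b).
have := dX a; have := dX b.
have := subset_leq_card (subsetT (nbhd X a :|: nbhd X b)); rewrite cardsT; lia.
Qed.

Lemma mindeg_relabel Y d (s : {perm V}) :
  mindeg_graph Y d -> mindeg_graph (relpre s Y) d.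
Proof.
case=> sY iY dY; split=> [x y|x|x]; rewrite /= ?iY //.
apply: leq_trans (dY (s x)) _; rewrite -(card_preimset _ (@perm_inj _ s)).
by apply/subset_leq_card/subsetP=> y; rewrite !inE.
Qed.

End Neighbourhoods.

(** * Swaps as permutations *)

Section Swaps.
Local Open Scope group_scope.
Variable V : finType.
Implicit Types (X Y : rel V) (s t : {perm V}).

(** The permutation s puts the person (s x) on the position x; X relates
    positions and Y relates persons. *)
Definition swap_step X Y : rel {perm V} := fun s t =>
  [exists a, [exists b, [&& X a b, Y (s a) (s b) & t == tperm a b * s]]].

Definition reach X Y := connect (swap_step X Y).

Lemma swap_stepP X Y s t :
  reflect (exists a b, [/\ X a b, Y (s a) (s b) & t = tperm a b * s])
          (swap_step X Y s t).
Proof.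
apply: (iffP existsP) => [[a /existsP[b /and3P[? ? /eqP?]]]|[a [b [? ? ->]]]].
  by exists a, b.
by exists a; apply/existsP; exists b; apply/and3P.
Qed.

Lemma reach_swap X Y s a b :
  X a b -> Y (s a) (s b) -> reach X Y s (tperm a b * s).
Proof. by move=> Xab Yab; apply/connect1/swap_stepP; exists a, b. Qed.

Lemma reach_sym X Y : symmetric Y -> connect_sym (swap_step X Y).
Proof.
move=> sY; apply: sym_connect_sym => s t.
suff {s t} : forall s t, swap_step X Y s t -> swap_step X Y t s.
  by move=> h; apply/idP/idP => /h.
move=> s t; case/swap_stepP=> a [b [Xab Yab ->]]; apply/swap_stepP; exists a, b.
by rewrite !permM tpermL tpermR sY mulgA tperm2 mul1g.
Qed.

(** Renaming the persons by s turns the placement s into the identity. *)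
Lemma reach_relabel X Y s t t' :
  reach X (relpre s Y) t t' -> reach X Y (t * s) (t' * s).
Proof.
apply: (connect_homo (f := mulg^~ s)) => {}t {}t'.
case/swap_stepP=> a [b [Xab /= Yab ->]]; apply/swap_stepP; exists a, b.
by rewrite !permM mulgA.
Qed.

(** Inversion exchanges positions and persons. *)
Lemma reach_inv X Y s t : reach X Y s t -> reach Y X s^-1 t^-1.
Proof.
apply: (connect_homo (f := invg)) => {}s {}t.
case/swap_stepP=> a [b [Xab Yab ->]]; apply/swap_stepP.
exists (s a), (s b); rewrite !permK; split=> //.
by rewrite invMg tpermV -tpermJ conjgE -!mulgA mulgV mulg1.
Qed.

(** A person walks along the positions occupied by its acquaintances: those it
    passes move one step back along the walk, so the set of positions occupied
    by acquaintances or by itself does not change. *)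
Lemma reach_travel X Y q s x y : irreflexive X -> s x = q ->
    connect [rel u v | X u v && (s v \in cnbhd Y q)] x y ->
  exists2 t, reach X Y s t & t y = q.
Proof.
move=> irrX sx /connectP[p].
(* The set B of positions is kept fixed while the state s varies. *)
have [B sB ->] : exists2 B : pred V, forall v, B v -> s v \in cnbhd Y q &
    [rel u v | X u v && (s v \in cnbhd Y q)] = [rel u v | X u v && B v].
  by exists (fun v => s v \in cnbhd Y q).
elim: p s x sx sB => [|z p IH] s x sx sB /=.
  by move=> _ ->; exists s => //; apply: connect0.
case/andP=> /andP[Xxz Bz] zp yl.
have zx : z != x by apply: contraTneq Xxz => ->; rewrite irrX.
have Yqz : Y q (s z).
  by have := sB _ Bz; rewrite !inE -{1}sx (inj_eq perm_inj) (negbTE zx).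
have [|v Bv|//|//|t st ty] := IH (tperm x z * s) z.
- by rewrite permM tpermR.
- rewrite permM; case: tpermP => [_|_|_ _]; first exact: sB.
    by rewrite sx !inE eqxx.
  exact: sB.
exists t => //; apply: connect_trans st.
by apply: reach_swap; rewrite ?sx.
Qed.

(** On the triangle a, b, p the persons of a and b, who may be strangers, change
    places with the help of their common acquaintance on p. *)
Lemma reach_exchange X Y s a b p :
    symmetric X -> symmetric Y -> irreflexive X ->
    X a b -> X a p -> X b p -> Y (s a) (s p) -> Y (s b) (s p) ->
  reach X Y s (tperm a b * s).
Proof.
move=> sX sY iX Xab Xap Xbp Yap Ybp.
have ne x y : X x y -> x != y by apply: contraTneq => ->; rewrite iX.
have [ab ap bp] := And3 (ne _ _ Xab) (ne _ _ Xap) (ne _ _ Xbp).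
pose s1 := tperm b p * s; pose s2 := tperm a b * s1.
have [ba pa pb] : [/\ b != a, p != a & p != b] by split; rewrite eq_sym.
have -> : tperm a b * s = tperm a p * s2.
  rewrite /s2 /s1 !mulgA; congr (_ * s); apply/permP=> x; rewrite !permM.
  have [->|xa] := eqVneq x a; first by rewrite !tpermL (tpermD ap bp) tpermR.
  have [->|xb] := eqVneq x b.
    by rewrite tpermR (tpermD ab pb) tpermR (tpermD ba pa).
  have [->|xp] := eqVneq x p.
    by rewrite (tpermD ap bp) tpermR !tpermL.
  by rewrite !tpermD // eq_sym.
apply: (@connect_trans _ _ s1); first exact: reach_swap.
apply: (@connect_trans _ _ s2); apply: reach_swap => //.
  by rewrite !permM tpermL tpermD.
by rewrite !permM tpermL tpermL (tpermD ap bp) tpermR sY.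
Qed.

(** A transposition of two positions at distance 2 is a product of three
    transpositions along edges, and transpositions generate. *)
Lemma reach_all X Y : symmetric X ->
    (forall x y, x != y -> ~~ X x y -> exists2 c, X x c & X c y) ->
    (forall s a b, X a b -> reach X Y s (tperm a b * s)) ->
  forall s, reach X Y 1 s.
Proof.
move=> sX cX rX.
have rT s x y : reach X Y s (tperm x y * s).
  have [->|xy] := eqVneq x y; first by rewrite tperm1 mul1g; apply: connect0.
  case: (boolP (X x y)) => [/rX//|/(cX _ _ xy)[c Xxc Xcy]].
  case: (eqVneq c x) => [e|cx]; first by apply: rX; rewrite -e.
  case: (eqVneq c y) => [e|cy]; first by apply: rX; rewrite -e.
  have -> : tperm x y = tperm x c * (tperm c y * tperm x c).
    rewrite -{1}[tperm x c]tpermV -conjgE tpermJ tpermR tpermD //.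
  rewrite -!mulgA; apply: connect_trans (rX _ _ _ Xxc) _.
  by apply: connect_trans (rX _ _ _ Xcy) _; apply: rX.
move=> s; have [ts -> _] := prod_tpermP s.
elim: ts => [|t ts IH]; first by rewrite big_nil; apply: connect0.
by rewrite big_cons; apply: connect_trans IH _; apply: rT.
Qed.

End Swaps.
(** * Bringing a person of Q to a position of P *)

(** Each set membership in the context doubles the case analysis done by the
    arithmetic procedure, hence they are discarded first. *)
Ltac card_lia :=
  repeat match goal with
  | H : is_true ?b |- _ => lazymatch b with leq _ _ => fail | _ => clear H end
  end; lia.

Section Meeting.
Variable V : finType.
Implicit Types X Y : rel V.

Definition meets X Y (P Q : {set V}) :=
  exists s : {perm V}, reach X Y 1%g s /\ exists2 p, p \in P & s p \in Q.

Lemma meets_dual X Y P Q : meets Y X Q P -> meets X Y P Q.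
Proof.
case=> s [rs [q qQ sqP]]; exists s^-1%g; split; last first.
  by exists (s q) => //; rewrite permK.
by rewrite -invg1; apply: reach_inv.
Qed.

(** The walk of the person q, with a bridge built at mu when p is not in the
    X-component of q among the positions held by acquaintances.  This is where
    the constant 9/14 is needed: it makes the defect E below at most a quarter
    of the size of K and of L. *)
Lemma meets_adj X Y d (P Q : {set V}) p q :
    mindeg_graph X d -> mindeg_graph Y d -> 9 * #|V| + 5 <= 14 * d ->
    p \in P -> q \in Q -> Y q p -> meets X Y P Q.
Proof.
move=> gX gY hd pP qQ Yqp; have [sX iX dX] := gX; have [sY iY dY] := gY.
pose A := cnbhd Y q; pose e := [rel u v | X u v && (v \in A)].
have [qA pA] : q \in A /\ p \in A by rewrite !inE eqxx Yqp orbT.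
case: (boolP (connect e q p)) => [qp|Nqp].
  have [|t rt tp] := @reach_travel _ X Y q 1%g q p iX (perm1 q).
    by under eq_connect => u v do rewrite /= perm1.
  by exists t; split=> //; exists p; rewrite ?tp.
pose K := [set x in A | connect e q x]; pose L := A :\: K.
have qK : q \in K by rewrite inE qA connect0.
have pL : p \in L by rewrite in_setD pA inE (negbTE Nqp) andbF.
have KL x y : x \in K -> y \in L -> ~~ X x y.
  rewrite inE => /andP[_ qx] /setDP[yA]; apply: contra => Xxy.
  rewrite inE yA; apply: connect_trans qx (connect1 _).
  by rewrite /= Xxy yA.
have LK x y : x \in L -> y \in K -> ~~ X x y by rewrite sX => *; apply: KL.
have dKL : [disjoint K & L].
  rewrite disjoint_sym disjoints_subset; apply/subsetP=> x /setDP[_].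
  by rewrite in_setC.
have cA : #|K| + #|L| = #|A|.
  by rewrite -(cardsID K A) (setIidPr _) //; apply/subsetP=> x /setIdP[].
have cM : #|A| + #|~: A| = #|V| by apply: cardsC.
have sAKL : A \subset K :|: L.
  by apply/subsetP=> x xA; rewrite in_setU in_setD xA andbT orbN.
have sKA : K \subset A by apply/subsetP=> x /setIdP[].
have sLA : L \subset A by apply: subsetDl.
have ltA : d < #|A| := cnbhd_card q gY.
have travelA (s : {perm V}) : s q = q ->
    connect [rel u v | X u v && (s v \in A)] q p ->
    exists2 t, reach X Y s t & t p = q by apply: reach_travel.
have Ymu mu : #|A :\: nbhd Y mu| + d <= #|V|.
  have d0 (B : {set V}) : [disjoint set0 & B] by rewrite -setI_eq0 set0I.
  by have := card_miss_le gY (d0 A) (d0 (nbhd Y mu)); rewrite cards0 addn0.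
clearbody L K A; clear e Nqp.
have dnb (B C : {set V}) x : B \subset C -> (forall y, y \in C -> ~~ X x y) ->
    [disjoint B & nbhd X x].
  move=> sBC h; rewrite disjoints_subset; apply/subsetP=> y /(subsetP sBC)/h.
  by rewrite !inE.
(* Both parts are large, as each contains the neighbours in A of one of its
   vertices. *)
have big x (B C : {set V}) : x \in A -> A \subset B :|: C ->
    (forall y, y \in C -> ~~ X x y) -> x \in B -> 2 * d + 2 <= #|B| + #|V|.
  move=> xA sA h xB.
  have sub : A :&: cnbhd X x \subset B.
    apply/subsetP=> y /setIP[/(subsetP sA)/setUP[//|/h nX]].
    by rewrite !inE (negbTE nX) orbF => /eqP->.
  have := subset_leq_card sub; have := cardsUI A (cnbhd X x).
  have := subset_leq_card (subsetT (A :|: cnbhd X x)); rewrite cardsT.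
  have := cnbhd_card x gX; card_lia.
have bK := big _ _ _ qA sAKL (fun y => KL q y qK) qK.
have bL : 2 * d + 2 <= #|L| + #|V|.
  by apply: (big p L K) => //; [rewrite setUC | move=> y; apply: LK].
(* A vertex of K is adjacent to no vertex of L, which has at least 2d + 2 - n
   elements, so it misses at most n - d - (2d + 2 - n) vertices of
   a set disjoint from L. *)
have [E defE] : exists E, E = 2 * #|V| - 3 * d - 2 by eexists.
have missK x (S : {set V}) : x \in K -> [disjoint L & S] ->
    #|S :\: nbhd X x| <= E.
  move=> xK dLS; have dL := dnb _ _ _ (subxx L) (fun y => KL x y xK).
  have := card_miss_le gX dLS dL; card_lia.
have missL x (S : {set V}) : x \in L -> [disjoint K & S] ->
    #|S :\: nbhd X x| <= E.
  move=> xL dKS; have dK := dnb _ _ _ (subxx K) (fun y => LK x y xL).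
  have := card_miss_le gX dKS dK; card_lia.
have dA (B : {set V}) : B \subset A -> [disjoint B & ~: A].
  by rewrite disjoints_subset setCK.
have missA x : x \in A -> #|~: A :\: nbhd X x| <= E.
  move=> /(subsetP sAKL)/setUP[xK|xL]; first by apply: missK => //; apply: dA.
  by apply: missL => //; apply: dA.
have qK0 : #|K :\: nbhd X q| <= E by apply: missK => //; rewrite disjoint_sym.
have pL0 : #|L :\: nbhd X p| <= E by apply: missL.
have one x : #|[set x] :\: nbhd X x| = 1%N.
  rewrite -(cards1 x); apply: eq_card => y; rewrite !inE.
  by case: eqP => [->|]; rewrite ?iX ?andbF.
have KE : #|K| + d < #|V|.
  have d1 : [disjoint K & [set p]].
    by rewrite disjoint_sym disjoints1 (disjointFl dKL pL).
  have := card_miss_le gX d1 (dnb _ _ _ (subxx K) (fun y => LK p y pL)).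
  by rewrite one.
have LE : #|L| + d < #|V|.
  have d1 : [disjoint L & [set q]].
    by rewrite disjoint_sym disjoints1 (disjointFr dKL qK).
  have := card_miss_le gX d1 (dnb _ _ _ (subxx L) (fun y => KL q y qK)).
  by rewrite one.
(* On average a position outside A misses at most |A| E / |V - A| <= 3 E
   vertices of A. *)
have [mu muM mumiss] : exists2 mu, mu \in ~: A & #|A :\: nbhd X mu| <= 3 * E.
  apply/exists_inP; apply: contraT; rewrite negb_exists_in => /forall_inP h.
  have up : \sum_(mu in ~: A) #|A :\: nbhd X mu| <= #|A| * E.
    by rewrite sum_missC // -sum_nat_const; apply: leq_sum => x /missA.
  have lo : #|~: A| * (3 * E).+1 <= \sum_(mu in ~: A) #|A :\: nbhd X mu|.
    by rewrite -sum_nat_const; apply: leq_sum => x /h; rewrite -ltnNge.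
  have A3 : #|A| * E <= 3 * #|~: A| * E by apply: leq_mul => //; card_lia.
  have M0 : 0 < #|~: A| by card_lia.
  have := leq_trans lo (leq_trans up A3); rewrite mulnS; card_lia.
have muA : mu \notin A by rewrite -in_setC.
have cS (B C : {set V}) (x : V) : B \subset C ->
    #|B :\: nbhd X x| <= #|C :\: nbhd X x|.
  by move=> s; apply/subset_leq_card/setSD.
(* The swap must displace neither q nor the person on p. *)
have [k0 [k0A Xk Yk k0pq]] : exists k0,
    [/\ k0 \in A, k0 \in nbhd X mu, k0 \in nbhd Y mu & k0 \in ~: [set p; q]].
  apply: pick_mem3; rewrite (setDE _ (~: _)) setCK.
  have := Ymu mu; have := subset_leq_card (subsetIr A [set p; q]).
  rewrite cards2; card_lia.
have [u [uK Xqu Xmu uk0]] : exists u,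
    [/\ u \in K, u \in nbhd X q, u \in nbhd X mu & u \in ~: [set k0]].
  apply: pick_mem3; rewrite (setDE _ (~: _)) setCK.
  have := subset_leq_card (subsetIr K [set k0]); rewrite cards1.
  have := cS _ _ mu sKA; card_lia.
have [v [vL Xpv Xmv vk0]] : exists v,
    [/\ v \in L, v \in nbhd X p, v \in nbhd X mu & v \in ~: [set k0]].
  apply: pick_mem3; rewrite (setDE _ (~: _)) setCK.
  have := subset_leq_card (subsetIr L [set k0]); rewrite cards1.
  have := cS _ _ mu sLA; card_lia.
move: Xk Yk k0pq Xqu Xmu uk0 Xpv Xmv vk0; rewrite !inE !negb_or.
move=> Xk Yk /andP[k0p k0q] Xqu Xmu uk0 Xpv Xmv vk0.
(* After the swap q walks from its place in K to u, over mu to v in L, to p. *)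
pose s := tperm k0 mu.
have sE x : x \in A -> x != k0 -> s x = x.
  move=> xA xk0; apply: tpermD; rewrite 1?eq_sym //.
  by apply: contraNneq muA => <-.
have [uA vA] := (subsetP sKA _ uK, subsetP sLA _ vL).
have [||t rt tp] := travelA s.
- by apply: sE; rewrite // eq_sym.
- apply/connectP; exists [:: u; mu; v; p] => //=.
  rewrite Xqu (sX u) Xmu Xmv (sX v) Xpv (sE u) // (sE v) // (sE p) 1?eq_sym //.
  by rewrite /s tpermR uA vA pA k0A.
exists t; split; last by exists p; rewrite ?tp.
apply: connect_trans rt; rewrite -[s]mulg1; apply: reach_swap.
  by rewrite sX.
by rewrite !perm1 sY.
Qed.

Lemma meets_relabel X Y (P Q : {set V}) (s : {perm V}) : reach X Y 1%g s ->
  meets X (relpre s Y) P (s @^-1: Q) -> meets X Y P Q.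
Proof.
move=> rs [t [rt [p pP]]]; rewrite inE => tp; exists (t * s)%g; split.
  by apply: connect_trans rs _; rewrite -{1}[s]mul1g; apply: reach_relabel.
by exists p; rewrite // permM.
Qed.

(** The bounds on P and Q are those satisfied by common neighbourhoods of two
    deleted vertices. *)
Lemma meets_of_mindeg X Y d (P Q : {set V}) :
    mindeg_graph X d -> mindeg_graph Y d -> 9 * #|V| + 5 <= 14 * d ->
    2 * d + 2 <= #|P| + #|V| -> 2 * d + 2 <= #|Q| + #|V| -> meets X Y P Q.
Proof.
move=> gX gY hd hP hQ; have [sX _ _] := gX; have [sY _ _] := gY.
have [p pP] : exists p, p \in P by apply/card_gt0P; card_lia.
have [q qQ] : exists q, q \in Q by apply/card_gt0P; card_lia.
case: (boolP [exists x in P, exists y in Q, (x == y) || X x y || Y y x]).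
  case/exists_inP=> x xP /exists_inP[y yQ /orP[/orP[/eqP xy|Xxy]|Yyx]].
  - by exists 1%g; split; [apply: connect0 | exists x; rewrite // perm1 xy].
  - by apply: meets_dual; apply: (meets_adj gY gX hd yQ xP Xxy).
  - exact: (meets_adj gX gY hd xP yQ Yyx).
rewrite negb_exists_in => /forall_inP no.
have {}no x y : x \in P -> y \in Q -> [/\ x != y, ~~ X x y & ~~ Y y x].
  move=> /no; rewrite negb_exists_in => /forall_inP h /h.
  by rewrite !negb_or => /andP[/andP[]].
have sub Z : (forall y, y \in Q -> ~~ Z p y) -> cnbhd Z p \subset ~: Q.
  move=> h; apply/subsetP=> y; rewrite !inE; apply: contraL => yQ.
  by rewrite negb_or h // andbT eq_sym; have [] := no _ _ pP yQ.
have sX' : cnbhd X p \subset ~: Q by apply: sub => y /(no _ _ pP)[].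
have sY' : cnbhd Y p \subset ~: Q.
  by apply: sub => y /(no _ _ pP)[]; rewrite sY.
have [r [rQ rX rY rYq]] : exists r, [/\ r \in ~: Q, r \in cnbhd X p,
    r \in cnbhd Y p & r \in cnbhd Y q].
  apply: pick_mem3; have := cardsC Q.
  have := cnbhd_card p gX; have := cnbhd_card p gY; have := cnbhd_card q gY.
  have := subset_leq_card (subsetIr (~: Q) (~: cnbhd Y q)); rewrite -setDE.
  have := cardsC (cnbhd Y q); have := subset_leq_card sX'.
  have := subset_leq_card sY'; rewrite (cardsDS sX') (cardsDS sY'); card_lia.
have [pq _ Yqp] := no _ _ pP qQ.
have Yqr : Y q r.
  by move: rQ rYq; rewrite !inE; case: eqP => [->|]; rewrite ?qQ.
have rp : r != p by apply: contraNneq Yqp => <-.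
have [Xpr Ypr] : X p r /\ Y p r by move: rX rY; rewrite !inE (negbTE rp).
have rs : reach X Y 1%g (tperm p r).
  by rewrite -[tperm p r]mulg1; apply: reach_swap; rewrite ?perm1.
have rq : r != q by apply: contraTneq qQ => <-; move: rQ; rewrite inE.
apply: (meets_relabel rs).
apply: (meets_adj (q := q) gX (mindeg_relabel _ gY) hd pP).
  by rewrite inE (tpermD pq rq); apply: qQ.
by rewrite /= tpermL (tpermD pq rq).
Qed.
End Meeting.

(** * Exchanging adjacent persons *)

Section Exchange.
Variable V : finType.
Implicit Types (X Y : rel V) (s : {perm V}).

(** Moves on the graphs induced on T are moves on the whole graphs that do not
    touch the positions outside T, whoever stands there. *)
Lemma reach_lift X Y (T : {set V}) (s : {perm V})
    (t t' : {perm {x | x \in T}}) :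
    (forall x, s (val x) = val (t x)) ->
    reach (relpre val X) (relpre val Y) t t' ->
  exists s', [/\ reach X Y s s', forall x, s' (val x) = val (t' x) &
                 forall x, x \notin T -> s' x = s x].
Proof.
move=> st /connectP[p + ->]; elim: p t s st => [|t1 p IH] t s st /=.
  by move=> _; exists s; split=> //; apply: connect0.
case/andP=> /swap_stepP[a [b [/= Xab Yab ->]]].
pose s1 := (tperm (val a) (val b) * s)%g.
case/(IH _ s1) => [x | s' [rs' s't' s'T]].
  rewrite !permM; case: tpermP => [/val_inj->|/val_inj->|xa xb].
  - by rewrite tpermL st.
  - by rewrite tpermR st.
  rewrite st tpermD //.
    by apply: contra_not_neq xa => ->.
  by apply: contra_not_neq xb => ->.
exists s'; split=> // [|x xT].
  by apply: connect_trans rs'; apply: reach_swap; rewrite ?st.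
rewrite s'T // permM tpermD //; apply: contraNneq xT => <-; exact: valP.
Qed.

Lemma mindeg_sub X d a b (T := ~: [set a; b]) :
  mindeg_graph X d ->
  mindeg_graph (relpre (val : {x | x \in T} -> V) X) (d - 2).
Proof.
case=> sX iX dX; split=> [x y|x|x]; [exact: sX | exact: iX |].
set N := nbhd _ x; rewrite leq_subLR; apply: leq_trans (dX (val x)) _.
have sub : nbhd X (val x) \subset [set a; b] :|: val @: N.
  apply/subsetP=> y; rewrite in_setU in_set => Xxy.
  case: (boolP (y \in [set a; b])) => //= yab.
  have yT : y \in T by rewrite in_setC.
  by apply/imsetP; exists (Sub y yT); rewrite ?in_set //= SubK.
apply: leq_trans (subset_leq_card sub) (leq_trans (leq_card_setU _ _) _).
by apply: leq_add; [rewrite cards2; case: eqP | exact: leq_imset_card].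
Qed.

Lemma card_common X d a b (T := ~: [set a; b]) : mindeg_graph X d ->
  2 * d <= #|[set x : {x | x \in T} | X a (val x) && X b (val x)]| + #|V|.
Proof.
move=> gX; have [sX iX _] := gX.
set C := [set x | _].
have sub : nbhd X a :&: nbhd X b \subset val @: C.
  apply/subsetP=> y; rewrite !inE => /andP[Xay Xby].
  have yT : y \in T.
    rewrite !inE negb_or; apply/andP; split.
      by apply: contraTneq Xay => ->; rewrite iX.
    by apply: contraTneq Xby => ->; rewrite iX.
  by apply/imsetP; exists (Sub y yT); rewrite ?in_set ?SubK ?Xay.
apply: leq_trans (card_nbhdI a b gX) _; rewrite leq_add2r.
exact: leq_trans (subset_leq_card sub) (leq_imset_card _ _).
Qed.

(** The degree bound passes to the graphs without a and b: there are n - 2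
    vertices and degrees at least d - 2, and 14 (d - 2) >= 9 (n - 2) + 5. *)
Lemma reach_tperm_id X Y d a b :
    mindeg_graph X d -> mindeg_graph Y d -> 9 * #|V| + 15 <= 14 * d -> X a b ->
  reach X Y 1%g (tperm a b).
Proof.
move=> gX gY hd Xab; have [sX iX dX] := gX; have [sY iY dY] := gY.
have ab : a != b by apply: contraTneq Xab => ->; rewrite iX.
pose T := ~: [set a; b].
have cT : #|{: {x | x \in T}}| + 2 = #|V|.
  rewrite card_sig -(cardsC [set a; b]) cards2 ab addnC.
  by congr addn; apply: eq_card.
have dV : d <= #|V| by apply: leq_trans (dX a) (max_card _).
have hT : 9 * #|{: {x | x \in T}}| + 5 <= 14 * (d - 2) by lia.
have big c : 2 * d <= c + #|V| ->
    2 * (d - 2) + 2 <= c + #|{: {x | x \in T}}| by lia.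
have [t [rt [p pP tpQ]]] :=
  meets_of_mindeg (mindeg_sub a b gX) (mindeg_sub a b gY) hT
    (big _ (card_common a b gX)) (big _ (card_common a b gY)).
have [x|s [rs st sT]] := @reach_lift X Y T 1%g 1%g t _ rt.
  by rewrite !perm1.
have [sa sb] : s a = a /\ s b = b.
  by split; rewrite sT ?perm1 // !inE eqxx ?orbT.
move: pP tpQ; rewrite !inE -st => /andP[Xap Xbp] /andP[Yap Ybp].
have rab : reach X Y s (tperm a b * s)%g.
  by apply: (reach_exchange (p := val p)); rewrite ?sa ?sb.
have tT (x : {x | x \in T}) : tperm a b (val x) = val x.
  have := valP x; rewrite !inE negb_or => /andP[xa xb].
  by rewrite tpermD // eq_sym.
(* The moves leading from 1 to s are undone with a and b exchanged. *)
have sYT : symmetric (relpre (val : {x | x \in T} -> V) Y).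
  by move=> x y; apply: sY.
have rt' := rt; rewrite /reach (reach_sym _ sYT) in rt'.
have [x|s' [rs' s'T s'ab]] := @reach_lift X Y T (tperm a b * s)%g t 1%g _ rt'.
  by rewrite permM tT.
suff <- : s' = tperm a b by apply: connect_trans rs (connect_trans rab rs').
apply/permP=> x; case: (boolP (x \in T)) => xT.
  have := s'T (Sub x xT); rewrite perm1 SubK => ->.
  by have := tT (Sub x xT); rewrite SubK.
rewrite s'ab // permM; move: xT; rewrite !inE negbK => /orP[]/eqP->.
  by rewrite tpermL sb.
by rewrite tpermR sa.
Qed.

Lemma reach_of_mindeg X Y d s :
    mindeg_graph X d -> mindeg_graph Y d -> 9 * #|V| + 15 <= 14 * d ->
  reach X Y 1%g s.
Proof.
move=> gX gY hd; have [sX iX dX] := gX.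
apply: reach_all => // [x y _ Nxy | {}s a b Xab].
  have : 0 < #|nbhd X x :&: nbhd X y|.
    have := card_nbhdI x y gX; have := leq_trans (dX x) (max_card _); lia.
  by case/card_gt0P=> c; rewrite !inE => /andP[Xxc]; exists c; rewrite // sX.
rewrite -{1}[s]mul1g; apply: reach_relabel.
exact: reach_tperm_id gX (mindeg_relabel s gY) hd Xab.
Qed.
End Exchange.

(** * The upper bound *)

Lemma min_degree_geP (G : sgraph) d :
  reflect (d <= #|G| /\ forall x : G, d <= degree x) (d <= min_degree G).
Proof.
apply: (iffP idP) => [h|[dG h]]; last first.
  by apply: (big_ind (leq d)) => // m p dm dp; rewrite leq_min dm.
split=> [|x]; first exact: leq_trans h (min_degree_le G).
apply: leq_trans h _; rewrite /min_degree.
have : x \in index_enum G by apply: mem_index_enum.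
elim: (index_enum G) => // y r IH; rewrite inE big_cons geq_min.
by case/predU1P=> [->|/IH->]; rewrite ?leqnn ?orbT.
Qed.

Lemma forces_connected_dense n d : 9 * n + 15 <= 14 * d -> forces_connected n d.
Proof.
move=> hd X Y cX cY /min_degree_geP[_ dX] /min_degree_geP[_ dY] s t.
have [/injectiveP sI _] := andP (valP s).
have [/injectiveP tI _] := andP (valP t).
have cXY : #|X| = #|Y| by rewrite cX cY.
have sB : bijective (val s) by apply: inj_card_bij; rewrite ?cXY.
have [g sg gs] := sB.
(* Renaming the persons by s makes s the identity permutation. *)
pose Y' : rel X := fun x y => adj (val s x) (val s y).
have gX : mindeg_graph (@adj X) d.
  by split; [apply: adj_sym | apply: adj_irrefl | ].
have gY : mindeg_graph Y' d.
  split=> [x y|x|x]; rewrite /Y' ?adj_irrefl //; first exact: adj_sym.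
  apply: leq_trans (dY (val s x)) _.
  rewrite /degree -(on_card_preimset (onW_bij _ sB)).
  by apply/subset_leq_card/subsetP=> y; rewrite !inE.
have bijP (p : {perm X}) : bijectiveb [ffun x => val s (p x)].
  apply/andP; split.
    by apply/injectiveP=> x y; rewrite !ffunE => /sI/perm_inj.
  apply/forallP=> y; apply/codomP; exists (p^-1 (g y))%g.
  by rewrite ffunE permKV gs.
pose f p : bijection X Y := Sub _ (bijP p).
have fE p x : val (f p) x = val s (p x) by rewrite SubK ffunE.
have gtI : injective (g \o val t) by apply: inj_comp => //; apply: can_inj gs.
have -> : s = f 1%g by apply/val_inj/ffunP=> x; rewrite fE perm1.
have -> : t = f (perm gtI) by apply/val_inj/ffunP=> x; rewrite fE permE /= gs.
apply: (connect_homo (f := f)) (reach_of_mindeg (perm gtI) gX gY _); last first.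
  by rewrite cX.
move=> p q /swap_stepP[a [b [Xab Yab ->]]].
apply/existsP; exists a; apply/existsP; exists b.
rewrite /Y' in Yab; rewrite Xab !fE !permM Yab.
rewrite tpermL tpermR !eqxx; apply/forallP=> c; apply/implyP=> /andP[ca cb].
by rewrite !fE permM tpermD // eq_sym.
Qed.

(** * The lower bound *)

Lemma card_residue n r : r < 5 -> n <= 5 * #|[set y : 'I_n | y %% 5 == r]| + r.
Proof.
move=> r5; suff -> : #|[set y : 'I_n | y %% 5 == r]| = (n + 4 - r) %/ 5 by lia.
rewrite -sum1_card (eq_bigl (fun y : 'I_n => y %% 5 == r)); last first.
  by move=> y; rewrite inE.
rewrite big_mkcond /=; elim: n => [|n IH]; first by rewrite big_ord0; lia.
by rewrite big_ord_recr /= IH; case: eqP; lia.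
Qed.

Section FiveBlocks.
Variables (n : nat) (D : seq nat).
Hypothesis symD : forall i, i < 5 -> (i \in D) = (4 * i %% 5 \in D).

(** Vertices are adjacent when the difference of their residues lies in D; the
    factor 4 stands for -1 modulo 5. *)
Definition block_adj : rel 'I_n :=
  fun x y => (x != y) && ((x + 4 * y) %% 5 \in D).

Lemma block_adj_sym : symmetric block_adj.
Proof.
move=> x y; rewrite /block_adj eq_sym symD ?ltn_pmod //.
by congr (_ && (_ \in D)); lia.
Qed.

Lemma block_adj_irrefl : irreflexive block_adj.
Proof. by move=> x; rewrite /block_adj eqxx. Qed.

Definition block_graph := SGraph block_adj_sym block_adj_irrefl.

(** The three blocks have distinct residues, of sum at most 2 + 3 + 4, and the
    vertex itself may lie in their union: hence 9 + 5. *)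
Lemma block_degree (x : 'I_n) (k1 k2 k3 : nat) :
    uniq [:: k1; k2; k3] -> {subset [:: k1; k2; k3] <= D} ->
    k1 < 5 -> k2 < 5 -> k3 < 5 ->
  3 * n <= 5 * #|[set y | block_adj x y]| + 14.
Proof.
move=> uk sk k15 k25 k35.
pose B k := [set y : 'I_n | y %% 5 == (x + 4 * k) %% 5].
have BE k : n <= 5 * #|B k| + (x + 4 * k) %% 5.
  by apply: card_residue; rewrite ltn_pmod.
have sub : B k1 :|: B k2 :|: B k3 \subset x |: [set y | block_adj x y].
  apply/subsetP=> y; rewrite !inE /= /block_adj [y == x]eq_sym => yk.
  case: (x == y) => //=.
  suff [k kk ->] : exists2 k, k \in [:: k1; k2; k3] & (x + 4 * y) %% 5 = k.
    exact: sk.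
  by case/orP: yk => [/orP[]|] /eqP yk; [exists k1 | exists k2 | exists k3];
    rewrite ?inE ?eqxx ?orbT //; lia.
have ne i j : i < 5 -> j < 5 -> i != j -> (x + 4 * i) %% 5 != (x + 4 * j) %% 5.
  by clear; lia.
have dis i j : i < 5 -> j < 5 -> i != j -> B i :&: B j = set0.
  move=> i5 j5 ij; apply/setP=> y; rewrite !inE; apply/negP=> /andP[/eqP yi].
  by rewrite yi; apply/negP/ne.
have lt5 k : (x + 4 * k) %% 5 < 5 by rewrite ltn_pmod.
move: uk; rewrite /= !inE negb_or andbT => /andP[/andP[k12 k13] k23].
have := subset_leq_card sub; rewrite cardsU1 inE block_adj_irrefl add1n.
have := cardsUI (B k1 :|: B k2) (B k3); have := cardsUI (B k1) (B k2).
rewrite setIUl !dis // setU0 cards0.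
have := (ne _ _ k15 k25 k12, ne _ _ k15 k35 k13, ne _ _ k25 k35 k23).
have := (lt5 k1, lt5 k2, lt5 k3); have := (BE k1, BE k2, BE k3).
move=> [[b1 b2] b3] [[l1 l2] l3] [[/eqP n12 /eqP n13] /eqP n23].
clearbody B; move: (#|[set _ | _]|) => deg; lia.
Qed.
End FiveBlocks.

Lemma not_forces_connected n d :
  5 * d + 10 < 3 * n -> ~ forces_connected n d.
Proof.
move=> hd fc.
pose DX : seq nat := [:: 0; 1; 4]; pose DY : seq nat := [:: 0; 2; 3].
have symX : forall i, i < 5 -> (i \in DX) = (4 * i %% 5 \in DX).
  by do 5?case=> //.
have symY : forall i, i < 5 -> (i \in DY) = (4 * i %% 5 \in DY).
  by do 5?case=> //.
pose X := @block_graph n _ symX; pose Y := @block_graph n _ symY.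
have cX : #|X| = n by apply: card_ord.
have cY : #|Y| = n by apply: card_ord.
have dX : d <= min_degree X.
  apply/min_degree_geP; rewrite cX; split=> [|x]; first by lia.
  have : 3 * n <= 5 * degree x + 14.
    exact: (@block_degree n DX x 0 1 4 isT (fun _ h => h) isT isT isT).
  by lia.
have dY : d <= min_degree Y.
  apply/min_degree_geP; rewrite cY; split=> [|x]; first by lia.
  have : 3 * n <= 5 * degree x + 14.
    exact: (@block_degree n DY x 0 2 3 isT (fun _ h => h) isT isT isT).
  by lia.
have bijP (p : {perm 'I_n}) : bijectiveb [ffun x : X => p x : Y].
  apply/andP; split.
    by apply/injectiveP=> x y; rewrite !ffunE => /perm_inj.
  by apply/forallP=> y; apply/codomP; exists (p^-1 y)%g; rewrite ffunE permKV.
pose f p : bijection X Y := Sub _ (bijP p).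
have fE p x : val (f p) x = p x by rewrite SubK ffunE.
have n1 : 1 < n by lia.
pose i0 : 'I_n := Ordinal (ltnW n1); pose i1 : 'I_n := Ordinal n1.
have [p + e] := connectP (fc X Y cX cY dX dY (f 1%g) (f (tperm i0 i1))).
have : forall x : X, val (f 1%g) x = x %[mod 5] by move=> x; rewrite fE perm1.
suff inv (s : bijection X Y) : (forall x : X, val s x = x %[mod 5]) ->
    path (@fs_adj X Y) s p ->
    forall x : X, val (last s p) x = x %[mod 5].
  by move=> h1 /(inv _ h1)/(_ i0); rewrite -e fE tpermL.
elim: p s {e} => //= t p IH s hs.
case/andP=> /existsP[a /existsP[b /and5P[+ + /eqP ta /eqP tb /forallP tc]]].
rewrite /= /block_adj => /andP[_ Xab] /andP[_ Yab]; apply: IH => x.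
(* The sets {0,1,4} and {0,2,3} of differences meet in 0 only. *)
have ab : a = b %[mod 5].
  have := hs a; have := hs b.
  move: Xab Yab; rewrite !inE; lia.
have := tc x; case: (eqVneq x a) => [->|xa] /=; first by rewrite -tb hs.
case: (eqVneq x b) => [->|xb] /=; first by rewrite -ta hs.
by move/eqP=> <-; apply: hs.
Qed.

(** * Both bounds *)

Local Open Scope ring_scope.

Theorem theorem1p3 (n : nat) (n_ge1 : (1 <= n)%N) :
  (d_ n)%:R >= 3 / 5 * n%:R - 2 :> rat
  /\ ((16 <= n)%N -> (d_ n)%:R <= 9 / 14 * n%:R + 2 :> rat).
Proof.
rewrite /d_; case: ex_minnP => d /asboolP fd dmin; split=> [|_].
  have : (3 * n <= 5 * d + 10)%N.
    rewrite leqNgt; apply/negP=> hd.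
    by apply: (@not_forces_connected n d) fd; lia.
  by rewrite -(ler_nat rat) natrD !natrM; lra.
have : (14 * d <= 9 * n + 28)%N.
  have : (d <= (9 * n + 28) %/ 14)%N.
    by apply/dmin/asboolP/forces_connected_dense; lia.
  by lia.
by rewrite -(ler_nat rat) natrD !natrM; lra.
Qed.
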